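(* Let $n$ be a nonnegative integer, $m$ a natural number (i.e. $m\ge 1$), and $f\in C^{2m-}$. Let $F$ be any antiderivative of $f$, and for real $a,b$ write $\int_a^b:=\int_a^b f(x)\,dx:=F(b)-F(a)$. Then $$\sum_{k=0}^{n-1}f(k)=A_m-R_m,$$ where $$A_m:=\sum_{j=1}^m\gamma_{m,j}\sum_{i=0}^{j-1}\int_{i-j/2}^{n-1+j/2-i}=\sum_{j=1}^m\gamma_{m,j}\sum_{i=0}^{j-1}\int_{-1+j/2-i}^{n-1+j/2-i}$$ $$=\sum_{\alpha=1-m}^{m-1}\tau_{m,1+|\alpha|}\int_{\alpha/2-1/2}^{n-1/2-\alpha/2}=\sum_{\alpha=1-m}^{m-1}\tau_{m,1+|\alpha|}\int_{-1/2-\alpha/2}^{n-1/2-\alpha/2}$$ $$=\tau_{m,1}\int_{-1/2}^{n-1/2}+\sum_{\alpha=1}^{m-1}\tau_{m,1+\alpha}\Big(\int_{\alpha/2-1/2}^{n-1/2-\alpha/2}+\int_{-\alpha/2-1/2}^{n-1/2+\alpha/2}\Big)$$ $$=\tau_{m,1}\int_{-1/2}^{n-1/2}+\sum_{\alpha=1}^{m-1}\tau_{m,1+\alpha}\Big(\int_{-1/2-\alpha/2}^{n-1/2-\alpha/2}+\int_{-1/2+\alpha/2}^{n-1/2+\alpha/2}\Big)$$ and $$R_m:=\frac1{(2m-1)!\,2^{2m+1}}\int_0^1 ds\,(1-s)^{2m-1}\int_{-1}^{1}dv\,v^{2m}\sum_{j=1}^m\gamma_{m,j}\,j^{2m+1}\sum_{k=0}^{n-1}f^{(2m)}(k+jsv/2).$$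 The sum of all the coefficients of the integrals in each of the expressions of $A_m$ above is $1$: $$\sum_{j=1}^m\gamma_{m,j}\sum_{i=0}^{j-1}1=\sum_{j=1}^m\gamma_{m,j}\,j=\sum_{\alpha=1-m}^{m-1}\tau_{m,1+|\alpha|}=1.$$ Moreover, if $M_{2m}$ is a real number such that $$\Big|\sum_{k=0}^{n-1}f^{(2m)}(k+w)\Big|\le M_{2m}\quad\text{for all } w\in[-m/2,m/2],$$ then $$|R_m|\le\frac{M_{2m}}{(2m+1)!\,2^{2m}}\sum_{j=1}^m|\gamma_{m,j}|\,j^{2m+1}.$$
   Context: For a natural number $\alpha$, $C^{\alpha-}$ denotes the set of all functions $f:\mathbb R\to\mathbb R$ having continuous derivatives $f^{(i)}$ of all orders $i=0,\dots,\alpha-1$ (with $f^{(0)}:=f$) and such that $f^{(\alpha-1)}$ is absolutely continuous, with a Radon–Nikodym derivative denoted by $f^{(\alpha)}$. Coefficients: for natural $m$ and $j\ge1$, $$\gamma_{m,j}:=(-1)^{j-1}\,\frac2j\,\binom{2m}{m+j}\Big/\binom{2m}{m},$$ and for $r\ge1$ $$\tau_{m,r}:=\sum_{\beta=0}^{\lfloor m/2-r/2\rfloor}\gamma_{m,r+2\beta}=\sum_{\beta=0}^{\infty}\gamma_{m,r+2\beta}$$ (binomial coefficients $\binom{2m}{m+j}$ with $j>m$ are $0$). The sum of an empty family is $0$. *)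

(* Defs.v *)
From HB Require Import structures.
From mathcomp Require Import all_boot all_order all_algebra.
From mathcomp Require Import all_classical all_reals all_analysis.
From mathcomp Require Import zify.

Set Implicit Arguments.
Unset Strict Implicit.
Unset Printing Implicit Defensive.

Import Order.TTheory GRing.Theory Num.Theory.
Import numFieldNormedType.Exports.

Local Open Scope classical_set_scope.
Local Open Scope ring_scope.

Definition abs_cont_on {R : realType} (a b : R) (h : R -> R) : Prop :=
  forall eps : R, 0 < eps -> exists2 delta : R, 0 < delta &
    forall (N : nat) (x y : 'I_N -> R),
      (forall i, [/\ a <= x i, x i <= y i & y i <= b]) ->
      trivIset [set: 'I_N] (fun i => `]x i, y i[%classic) ->
      \sum_(i < N) (y i - x i) < delta ->
      \sum_(i < N) `|h (y i) - h (x i)| < eps.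

(* Absolute continuity of a function on the whole line is understood locally,
   i.e. on every compact interval. *)
Definition abs_cont {R : realType} (h : R -> R) : Prop :=
  forall a b : R, abs_cont_on a b h.

(* The class C^{alpha-}, for alpha >= 1. *)
Definition Cminus {R : realType} (alpha : nat) (f : R -> R) : Prop :=
  [/\ forall i, (i.+1 < alpha)%N -> forall x, derivable f^`(i)%classic x 1,
      forall i, (i < alpha)%N -> continuous f^`(i)%classic &
      abs_cont f^`(alpha.-1)%classic].

(* g is a density, with respect to the Lebesgue measure, of the signed measure
   dh given on compact intervals by h b - h a; such a g is only determined
   almost everywhere, whence a relation. *)
Definition is_RN_derivative {R : realType} (h g : R -> R) : Prop :=
  locally_integrable [set: R] g /\
  forall a b : R, a <= b ->
    h b - h a = \int[lebesgue_measure]_(x in `[a, b]) g x.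

Definition gamma (R : realType) (m j : nat) : R :=
  (-1) ^+ j.-1 * (2 / j%:R) * 'C(2 * m, m + j)%:R / 'C(2 * m, m)%:R.

(* (m.+2 - r)./2 is the number of naturals beta <= floor (m/2 - r/2); it is 0
   for r > m. *)
Definition tau (R : realType) (m r : nat) : R :=
  \sum_(0 <= beta < (m.+2 - r)./2) gamma R m (r + 2 * beta).

Lemma tau_widen (R : realType) (m r N : nat) :
  (0 < r)%N -> ((m.+2 - r)./2 <= N)%N ->
  tau R m r = \sum_(0 <= beta < N) gamma R m (r + 2 * beta).
Proof.
move=> r0 leN; rewrite (big_cat_nat (leq0n _) leN) /= [X in _ + X]big_nat_cond.
rewrite [X in _ + X]big1 ?addr0// => b /andP[/andP[hb _] _].
rewrite /gamma bin_small ?mulr0 ?mul0r// mul2n -addnn ltn_add2l.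
move: hb; rewrite leq_half_double mul2n => hb.
by rewrite -ltnS ltnNge; apply/negP => h; lia.
Qed.

(* The integers a, a + 1, ..., b, in this order; empty if b < a. *)
Definition zrange (a b : int) : seq int :=
  if a <= b then [seq a + k%:Z | k <- iota 0 `|b - a|%N.+1] else [::].

Lemma mem_zrange (a b z : int) : (z \in zrange a b) = (a <= z <= b).
Proof.
rewrite /zrange; case: ifP => [ab|/negbT ab]; last first.
  by rewrite in_nil; apply/esym/negbTE; lia.
apply/mapP/idP => [[k]|/andP[az zb]].
  by rewrite mem_iota => ? ->; lia.
by exists `|z - a|%N; [rewrite mem_iota|]; lia.
Qed.

Lemma zrange_uniq (a b : int) : uniq (zrange a b).
Proof.
rewrite /zrange; case: ifP => // _; rewrite map_inj_uniq ?iota_uniq// => i j.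
by move/addrI => -[].
Qed.

(* The remainder R_m, with g in the role of the derivative of order 2m. *)
Definition remainder {R : realType} (n m : nat) (g : R -> R) : R :=
  ((2 * m - 1)`!%:R * 2 ^+ (2 * m + 1))^-1 *
  \int[lebesgue_measure]_(s in `[0, 1]) ((1 - s) ^+ (2 * m - 1) *
    \int[lebesgue_measure]_(v in `[-1, 1]) (v ^+ (2 * m) *
      \sum_(1 <= j < m.+1) (gamma R m j * j%:R ^+ (2 * m + 1) *
        \sum_(0 <= k < n) g (k%:R + j%:R * s * v / 2)))).

(* Main.v *)
(* Let g be the density of the derivative of order 2m - 1. Integrating the
   Taylor formula with integral remainder of f at k over [k - j/2, k + j/2]
   expands the integral of f over that interval in the even derivatives of f at
   k, the derivative of order 2a having a coefficient proportional to
   j^(2a + 1), with the (j-th, k-th) term of the remainder R_m as error. The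
   weights gamma_(m,j) satisfy sum_j gamma_(m,j) j^(2a + 1) = [a = 0] for a < m,
   because a finite difference of order 2m kills polynomials of degree < 2m; so
   the weighted sum over j is f(k) plus the error, and the sum over k telescopes
   to A_m. The other forms of A_m group the pairs (j, i) by 2i + 1 - j.

   Since g is merely locally integrable, integration by parts and the exchange
   of the integrals in s and v go through Fubini's theorem. *)

Require Import Defs.
From HB Require Import structures.
From mathcomp Require Import all_boot all_order all_algebra.
From mathcomp Require Import all_classical all_reals all_analysis.
From mathcomp Require Import measurable_realfun zify ring lra.

Set Implicit Arguments.
Unset Strict Implicit.
Unset Printing Implicit Defensive.

Import Order.TTheory GRing.Theory Num.Theory.
Import numFieldNormedType.Exports.

Local Open Scope classical_set_scope.
Local Open Scope ring_scope.

(** * Weights and reindexing *)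

(** Induction on N: by Pascal's rule the sum of order N + 1 is the difference of the sums of order N
    at the shifts c and c + 1. Expanding the second one in powers of i + c cancels the terms of
    degree d, and those of lower degree vanish by induction. *)
Lemma alternating_binomial_sum (A : comPzRingType) (N d : nat) (c : A) :
  (d < N)%N ->
  \sum_(0 <= i < N.+1) (-1) ^+ i * 'C(N, i)%:R * (i%:R + c) ^+ d = 0.
Proof.
elim: N d c => // N IH d c dN.
pose S d c : A := \sum_(0 <= i < N.+1) (-1) ^+ i * 'C(N, i)%:R * (i%:R + c) ^+ d.
have SE : \sum_(0 <= i < N.+2) (-1) ^+ i * 'C(N.+1, i)%:R * (i%:R + c) ^+ d =
    S d c - S d (c + 1).
  rewrite big_nat_recl//= bin0.
  under eq_big_nat => i _ do
    rewrite binS natrD mulrDr mulrDl exprS mulN1r !mulNr -natr1 -(addrA _ 1) (addrC 1).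
  rewrite big_split/= !sumrN addrA; congr (_ - _).
  rewrite /S [RHS]big_nat_recl// bin0; congr (_ + _).
  rewrite big_nat_recr//= bin_small// mulr0 mul0r addr0 -sumrN.
  apply: eq_big_nat => i _.
  by rewrite exprS mulN1r !mulNr -natr1 -addrA (addrC 1).
rewrite SE {2}/S.
under eq_big_nat => i _ do rewrite addrA exprD1n mulr_sumr.
rewrite exchange_big big_ord_recr/= -/(S d c) binn.
rewrite [X in _ - (X + _)]big1 ?add0r => [|e _].
  apply/eqP; rewrite subr_eq0; apply/eqP; apply: eq_bigr => i _.
  by rewrite mulr1n.
have /(congr1 (fun x => x *+ 'C(d, e))) := IH e c (leq_trans (ltn_ord e) dN).
rewrite mul0rn -sumrMnl; apply: etrans.
by apply: eq_bigr => i _; rewrite mulrnAr.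
Qed.

(** The factor 1/j of [gamma] lowers the exponent to 2a, so the sum is, up to a constant, the upper
    half of an alternating binomial sum of order 2m centred at m. The two halves are equal and the
    whole sum is 0, so each half is minus half of the central term, which contains 0^(2a) and
    survives only for a = 0. *)
Lemma gamma_odd_moment (R : realType) (m a : nat) : (a < m)%N ->
  \sum_(1 <= j < m.+1) gamma R m j * j%:R ^+ (2 * a + 1) = (a == 0)%:R.
Proof.
move=> am.
pose T i : R := (-1) ^+ i * 'C(2 * m, i)%:R * (i%:R - m%:R) ^+ (2 * a).
have C0 : 'C(2 * m, m)%:R != 0 :> R by rewrite pnatr_eq0 -lt0n bin_gt0; lia.
have gT j : (0 < j)%N -> (j <= m)%N ->
    gamma R m j * j%:R ^+ (2 * a + 1) =
    - (2 * (-1) ^+ m / 'C(2 * m, m)%:R) * T (m + j)%N.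
  case: j => // j _ jm; rewrite /gamma /T natrD (addrC m%:R) addrK /=.
  have j0 : j.+1%:R != 0 :> R by rewrite pnatr_eq0.
  have s2 : (-1) ^+ m * (-1) ^+ m = 1 :> R by rewrite -expr2 sqrr_sign.
  have -> : (-1) ^+ (m + j.+1) = - ((-1) ^+ m * (-1) ^+ j) :> R.
    by rewrite exprD exprS; ring.
  rewrite exprD expr1.
  (* Inserting 1 as the square of (-1)^m makes both sides agree as polynomials in the two signs, so
     that [field] needs no relation between them. *)
  rewrite -[LHS]mul1r -{1}s2; move: ((-1) ^+ m) ((-1) ^+ j) => s t; field.
  by rewrite C0 addrC natr1 j0.
under eq_big_nat => j /andP[j0 jm] do rewrite gT//.
rewrite -mulr_sumr.
have Tsym j : (j <= m)%N -> T (m + j)%N = T (m - j)%N.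
  move=> jm; rewrite /T -(@bin_sub _ (m - j)%N); last lia.
  have -> : (2 * m - (m - j) = m + j)%N by lia.
  rewrite natrD natrB// (addrC m%:R) addrK.
  have -> : m%:R - j%:R - m%:R = - j%:R :> R by ring.
  rewrite [in RHS]exprM sqrrN -[in RHS]exprM; congr (_ * _ * _).
  by rewrite -signr_odd -[RHS]signr_odd oddD oddB.
have := @alternating_binomial_sum R (2 * m) (2 * a) (- m%:R) ltac:(lia).
rewrite -/T (@big_cat_nat _ _ _ m)//=; [|lia].
(* Reversing the lower half sends i to m - i.+1, which [Tsym] reflects to m + i.+1. *)
rewrite big_nat_rev/= add0n (eq_big_nat _ _ (F2 := fun i => T (m + i.+1)%N)); last first.
  move=> i /andP[_ im]; rewrite Tsym//.
rewrite [X in _ + X]big_nat_recl//; last lia.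
pose S : R := \sum_(0 <= i < m) T (m + i.+1)%N.
have -> : \sum_(m <= i < 2 * m) (-1) ^+ i.+1 * 'C(2 * m, i.+1)%:R *
    (i.+1%:R - m%:R) ^+ (2 * a) = S.
  rewrite -{1}[m]add0n big_addn mul2n -addnn addnK.
  by apply: eq_bigr => i _; rewrite /T addnS addnC addnn -mul2n.
rewrite -/S big_add1/= -/S subrr expr0n muln_eq0/= => SS.
have s2 : (-1) ^+ m * (-1) ^+ m = 1 :> R by rewrite -expr2 sqrr_sign.
have {SS} -> : S = - ((-1) ^+ m * 'C(2 * m, m)%:R * (a == 0)%:R) / 2 by lra.
move: s2 C0; move: ((-1) ^+ m) => s s2 C0.
transitivity (s * s * (a == 0)%:R); last by rewrite s2 mul1r.
by field.
Qed.

(* Group the pairs (j, i) according to the value 2i + 1 - j of the argument of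
   phi. *)
Lemma sum_antisymmetric_range (A : pzRingType) (m : nat) (c : nat -> A)
    (phi : int -> A) : (forall j, (m < j)%N -> c j = 0) ->
  \sum_(1 <= j < m.+1) c j * (\sum_(0 <= i < j) phi ((2 * i).+1%:Z - j%:Z)) =
  \sum_(0 <= a < m) (\sum_(0 <= b < m) c (1 + a + 2 * b)%N) *
    (if a == 0%N then phi 0 else phi a%:Z + phi (- a%:Z)).
Proof.
move=> cm; pose psi a := if a == 0%N then phi 0 else phi a%:Z + phi (- a%:Z).
(* For fixed j the arguments of [phi] run from 1 - j to j - 1 in steps of 2. Removing both ends
   leaves the arguments for j - 2, so the induction goes down by two; [psi] pairs opposite arguments
   and counts 0 once. *)
have inner j : \sum_(0 <= i < j) phi ((2 * i).+1%:Z - j%:Z) =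
    \sum_(0 <= b < j) (if (2 * b < j)%N then psi (j - 1 - 2 * b)%N else 0).
  have [k] := ubnP j; elim: k j => // k IH [|[|j]] jk.
  - by rewrite !big_geq.
  - by rewrite !big_nat1.
  rewrite big_nat_recl// big_nat_recr//= [RHS]big_nat_recl// [in RHS]big_nat_recr//=.
  rewrite (_ : (2 * j.+1 < j.+2)%N = false) ?addr0; last lia.
  rewrite addrCA addrC; congr (_ + _).
    by rewrite addrC muln0 subn0 subn1 /psi /=; congr (phi _ + phi _); lia.
  under eq_bigr => i _ do [rewrite (_ : (2 * i.+1).+1%:Z - j.+2%:Z = (2 * i).+1%:Z - j%:Z); last lia].
  rewrite IH; last lia.
  apply: eq_bigr => b _; rewrite (_ : (2 * b.+1 < j.+2)%N = (2 * b < j)%N); last lia.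
  by case: ifP => // bj; congr psi; lia.
rewrite big_add1/=.
transitivity (\sum_(0 <= j < m) \sum_(0 <= b < m)
    (if (2 * b <= j)%N then c j.+1 * psi (j - 2 * b)%N else 0)).
  apply: eq_big_nat => j /andP[_ jm]; rewrite inner mulr_sumr.
  rewrite [RHS](@big_cat_nat _ _ _ j.+1)//= [X in _ = _ + X]big1_seq ?addr0.
    apply: eq_bigr => b _; rewrite ltnS subn1 /=; case: ifP => //.
    by rewrite mulr0.
  by move=> b; rewrite mem_index_iota => /andP[_ ?]; rewrite ifF//; lia.
under [RHS]eq_bigr do rewrite mulr_suml.
rewrite exchange_big [RHS]exchange_big/=; apply: eq_bigr => b _.
(* Since [c] vanishes beyond m, the range of j may be extended by 2b; after the shift a = j - 2b it
   becomes 0 <= a < m for every b. *)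
transitivity (\sum_(0 <= j < m + 2 * b)
    (if (2 * b <= j)%N then c j.+1 * psi (j - 2 * b)%N else 0)).
  rewrite [RHS](@big_cat_nat _ _ _ m)//= ?leq_addr// [X in _ = _ + X]big1_seq ?addr0//.
  move=> j; rewrite mem_index_iota => /andP[_ ?]; case: ifP => // _.
  by rewrite cm ?mul0r//; lia.
rewrite (@big_cat_nat _ _ _ (2 * b))//= ?leq_addl// big1_seq ?add0r; last first.
  by move=> j; rewrite mem_index_iota => /andP[_ ?]; rewrite ifF//; lia.
rewrite -{1}[(2 * b)%N]add0n big_addn addnK; apply: eq_bigr => a _.
by rewrite leq_addl addnK add1n addSn.
Qed.

Lemma sum_zrange (A : nmodType) (m : nat) (G : int -> A) : (0 < m)%N ->
  \sum_(al <- zrange (1 - m%:Z) (m%:Z - 1)) G al =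
  G 0 + \sum_(1 <= a < m) (G a%:Z + G (- a%:Z)).
Proof.
case: m => // m _; rewrite /zrange ifT; last lia.
rewrite big_map (_ : absz ((m.+1%:Z - 1 - (1 - m.+1%:Z))%R : int) = (2 * m)%N); last lia.
rewrite -[iota _ _]/(index_iota 0 (2 * m).+1) -[1%N]/(0.+1) big_add1 /=.
under eq_bigr => k _ do [rewrite (_ : 1 - m.+1%:Z + k%:Z = k%:Z - m%:Z); last lia].
elim: m => [|m IH]; first by rewrite muln0 big_nat1 big_geq// !addr0.
rewrite mulnS big_nat_recl// big_nat_recr//= [in RHS]big_nat_recr//=.
rewrite [in RHS]addrA -IH addrCA; congr (_ + _); last first.
  by rewrite addrC; congr (G _ + G _); lia.
by apply: eq_bigr => k _; congr G; lia.
Qed.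

(** * Change of variables and Fubini's theorem *)

Section affine_change_of_variable.
Context {R : realType}.
Variables (k a : R).
Hypothesis a_neq0 : a != 0.
Local Notation mu := (@lebesgue_measure R).
Let aff : measurableTypeR R -> measurableTypeR R := fun x => k + a * x.

Let maff : measurable_fun setT aff.
Proof. by apply: measurable_funD => //; apply: mulrl_measurable. Qed.

Lemma measurable_fun_affine (d : measure_display) (T : measurableType d)
    (f : R -> T) : measurable_fun setT f ->
  measurable_fun setT (fun x => f (k + a * x)).
Proof. by move=> mf; exact: (measurableT_comp mf maff). Qed.

Let absa : {nonneg R} := NngNum (normr_ge0 a).

(** The right-hand side is a measure in A, a multiple of a push-forward of [mu], so it suffices to
    compare the two on half-open intervals. For a < 0 the preimage is closed on the left and open on
    the right, which does not change its length. *)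
Lemma lebesgue_measure_affine (A : set R) : measurable A ->
  mu A = (`|a|%:E * mu ((fun x => k + a * x)%R @^-1` A))%E.
Proof.
move=> mA.
pose nu : {measure set (measurableTypeR R) -> \bar R} :=
  mscale absa (measure_function_pushforward__canonical__measure_function_Measure mu maff).
transitivity (nu A) => //; apply: lebesgue_measure_unique => // _ [[s t] _ <-].
rewrite /nu /= /mscale /= /pushforward lebesgue_measure_itv /= lte_fin.
have [a0|a0] := ltP 0 a.
- have -> : aff @^-1` `]s, t]%classic = `](s - k) / a, (t - k) / a]%classic.
    apply/seteqP; split=> x /=; rewrite !in_itv/= /aff;
      by rewrite ltr_pdivrMr// ler_pdivlMr// ltrBlDl lerBrDl (mulrC x).
  rewrite lebesgue_measure_itv/= lte_fin ltr_pM2r ?invr_gt0// ltrD2r.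
  case: ifPn => st; last by rewrite mule0.
  by rewrite gtr0_norm// -!EFinD -EFinM; congr EFin; field.
- have {}a0 : a < 0 by rewrite lt_neqAle a_neq0.
  have -> : aff @^-1` `]s, t]%classic = `[(t - k) / a, (s - k) / a[%classic.
    apply/seteqP; split=> x /=; rewrite !in_itv/= /aff;
      by rewrite ltr_ndivlMr// ler_ndivrMr// ltrBlDl lerBrDl (mulrC x) andbC.
  rewrite lebesgue_measure_itv/= lte_fin ltr_nM2r ?invr_lt0// ltrD2r.
  case: ifPn => st; last by rewrite mule0.
  by rewrite ltr0_norm// -!EFinD -EFinM; congr EFin; field.
Qed.

Lemma ge0_integral_affine (f : R -> \bar R) :
  measurable_fun setT f -> (forall x, 0 <= f x)%E ->
  (\int[mu]_x f x = `|a|%:E * \int[mu]_x f (k + a * x)%R)%E.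
Proof.
move=> mf f0.
pose P : {measure set (measurableTypeR R) -> \bar R} :=
  measure_function_pushforward__canonical__measure_function_Measure mu maff.
transitivity (\int[mscale absa P]_x f x)%E.
  by apply: eq_measure_integral => A mA _; exact: lebesgue_measure_affine.
rewrite ge0_integral_mscale//=; congr (_ * _)%E.
rewrite (@ge0_integral_pushforward _ _ _ _ _ _ maff)//.
Qed.

(** Extending f by 0 outside D moves the question to the whole line. There [ge0_integral_affine]
    gives integrability from the absolute value and the formula from the positive and negative
    parts. *)
Lemma affine_integral (D : set R) (f : R -> R) : measurable D ->
    measurable_fun setT f -> mu.-integrable D (EFin \o f) ->
  mu.-integrable ((fun x => k + a * x) @^-1` D) (fun x => (f (k + a * x))%:E) /\
  \int[mu]_(x in D) f x =
    `|a| * \int[mu]_(x in (fun x => k + a * x) @^-1` D) f (k + a * x).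
Proof.
move=> mD mf iDf.
have mD' : measurable (aff @^-1` D) by rewrite -[X in measurable X]setTI; exact: maff.
pose F : R -> \bar R := (EFin \o f) \_ D.
have FE : (fun x => (f (k + a * x))%:E) \_ (aff @^-1` D) = F \o aff.
  by apply/funext => x; rewrite /F /= !patchE.
have iF : mu.-integrable setT F by rewrite /F -integrable_mkcond.
have mF : measurable_fun setT F := measurable_int _ iF.
have iFa : mu.-integrable setT (F \o aff).
  apply/integrableP; split; first exact: measurableT_comp.
  have /integrableP[_] := iF.
  rewrite ge0_integral_affine//; last exact: measurableT_comp.
  rewrite muleC -lte_pdivlMr ?normr_gt0//.
  by rewrite gt0_mulye// lte_fin invr_gt0 normr_gt0.
split; first by apply/integrable_mkcond => //; rewrite FE.
rewrite /Rintegral [in LHS]integral_mkcond [in RHS]integral_mkcond FE.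
rewrite -/F -[X in _ * fine X]/(\int[mu]_x (F \o aff) x)%E.
suff -> : (\int[mu]_x F x = `|a|%:E * \int[mu]_x (F \o aff) x)%E.
  by rewrite fineM// integrable_fin_num.
rewrite [LHS]integralE (ge0_integral_affine (f := F^\+)%E)//; last first.
  exact: measurable_funepos.
rewrite (ge0_integral_affine (f := F^\-)%E)//; last exact: measurable_funeneg.
have := integrable_add_def measurableT iFa; rewrite funepos_comp funeneg_comp => aF.
by rewrite [in RHS]integralE funepos_comp funeneg_comp -muleBr.
Qed.

End affine_change_of_variable.

Section fubini_on_rectangle.
Context {R : realType}.
Local Notation mu := (@lebesgue_measure R).
Variables (D E : set R) (K : R -> R -> R).
Hypotheses (mD : measurable D) (mE : measurable E).
Hypothesis mK : measurable_fun setT (fun z : R * R => K z.1 z.2).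
Hypothesis intKx : forall x, D x -> mu.-integrable E (EFin \o K x).
Hypothesis intKy : forall y, E y -> mu.-integrable D (EFin \o K^~ y).
Variable B : R -> R.
Hypothesis intB : mu.-integrable D (EFin \o B).
Hypothesis KB : forall x, D x -> (\int[mu]_(y in E) `|K x y|%:E <= (B x)%:E)%E.

(** Extending the kernel by 0 off the rectangle allows Fubini's theorem on the whole plane. *)
Let L (z : R * R) : \bar R := (((fun z => K z.1 z.2) \_ (D `*` E)) z)%:E.

Let LE x y : L (x, y) = ((fun x => ((K x \_ E) y)%:E) \_ D) x.
Proof.
rewrite /L !patchE in_setX; case: (x \in D) => //=; case: (y \in E) => //.
Qed.

Let mL : measurable_fun setT L.
Proof.
apply/measurable_EFinP/(measurable_restrictT _ _).1.
  exact: measurableX.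
exact: measurable_funTS.
Qed.

(** Tonelli's criterion: the iterated integral of the absolute value is dominated by the integral of
    [B]. *)
Let iL : (mu \x mu)%E.-integrable setT L.
Proof.
apply/integrable12ltyP => //.
have LB x : (\int[mu]_y `|L (x, y)| <= ((EFin \o B) \_ D) x)%E.
  rewrite patchE; case: ifPn => xD; last first.
    by rewrite integral0_eq// => y _; rewrite LE patchE (negbTE xD) abse0.
  apply: le_trans (KB (set_mem xD)); rewrite [leRHS]integral_mkcond.
  rewrite le_eqVlt; apply/orP; left; apply/eqP; apply: eq_integral => y _.
  by rewrite LE !patchE xD; case: ifPn => //=; rewrite ?abse0 ?normr0.
have iBD : mu.-integrable setT ((EFin \o B) \_ D) by rewrite -integrable_mkcond.
apply: le_lt_trans (integrable_lty measurableT iBD).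
apply: ge0_le_integral => //.
- by move=> x _; apply: integral_ge0 => y _; exact: abse_ge0.
- have mabsL : measurable_fun setT (abse \o L) by exact: measurableT_comp.
  have := measurable_fun_fubini_tonelli_F (m2 := mu) _ mabsL.
  by apply => z; exact: abse_ge0.
- exact: measurable_int iBD.
Qed.

(** [Rintegral] is the [fine] of an extended integral, so a pointwise identification uses the
    integrability of every section over D, which is [intKx]. *)
Let LF : fubini_F mu L = (fun x => (\int[mu]_(y in E) K x y)%:E) \_ D.
Proof.
apply/funext => x; rewrite /fubini_F patchE; case: ifPn => xD.
  rewrite /Rintegral fineK; last by apply: integrable_fin_num => //; apply/intKx/set_mem.
  rewrite [RHS]integral_mkcond; apply: eq_integral => y _.
  by rewrite LE patchE xD !patchE; case: ifPn.
by apply: integral0_eq => y _; rewrite LE patchE (negbTE xD).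
Qed.

Let LG : fubini_G mu L = (fun y => (\int[mu]_(x in D) K x y)%:E) \_ E.
Proof.
apply/funext => y; rewrite /fubini_G patchE; case: ifPn => yE.
  rewrite /Rintegral fineK; last by apply: integrable_fin_num => //; apply/intKy/set_mem.
  rewrite [RHS]integral_mkcond; apply: eq_integral => x _.
  by rewrite LE !patchE yE; case: ifPn.
apply: integral0_eq => x _; rewrite LE !patchE (negbTE yE); by case: ifPn.
Qed.

(** The absolute value of the inner integral is at most the inner integral of the absolute value of
    [L], whose own integral in y is finite by Tonelli. *)
Lemma integrable_Rintegral_snd :
  mu.-integrable E (EFin \o (fun y => \int[mu]_(x in D) K x y)).
Proof.
apply/integrable_mkcond => //; rewrite -LG; apply/integrableP; split.
  exact: (measurable_fubini_G iL).
have LGoo : (\int[mu]_y \int[mu]_x `|L (x, y)| < +oo)%E by apply/(integrable21ltyP mu mu mL).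
apply: le_lt_trans LGoo.
apply: ge0_le_integral => //.
- by apply: measurableT_comp => //; exact: (measurable_fubini_G iL).
- have mabsL : measurable_fun setT (abse \o L) by exact: measurableT_comp.
  have := measurable_fun_fubini_tonelli_G (m1 := mu) _ mabsL.
  by apply => z; exact: abse_ge0.
- move=> y _; apply: le_abse_integral => //.
  exact: measurable_fun_pair1 y mL.
Qed.

Lemma Rintegral_fubini :
  \int[mu]_(x in D) (\int[mu]_(y in E) K x y) =
  \int[mu]_(y in E) (\int[mu]_(x in D) K x y).
Proof.
rewrite {1}/Rintegral [X in fine X]integral_mkcond -LF.
rewrite [in RHS]/Rintegral [X in _ = fine X]integral_mkcond -LG.
by congr fine; exact: Fubini.
Qed.

End fubini_on_rectangle.

(** * Taylor's formula with an integrable last derivative *)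

Section primitives.
Context {R : realType}.
Local Notation mu := (@lebesgue_measure R).

(** Antiderivatives in the integral sense, with no pointwise derivative: this covers both C^1
    functions and an absolutely continuous function with its density. Measurability on the whole
    line serves compositions with affine maps and product kernels. *)
Definition primitive (g h : R -> R) :=
  [/\ measurable_fun setT g,
      forall s t, mu.-integrable `[s, t] (EFin \o g) &
      forall s t, s <= t -> \int[mu]_(x in `[s, t]) g x = h t - h s].

Lemma is_RN_derivative_primitive (h g : R -> R) :
  is_RN_derivative h g -> primitive g h.
Proof.
case=> -[mg _ ig] gh; split => // [s t|s t st]; last by rewrite gh.
apply/integrableP; split; first exact/measurable_EFinP/measurable_funTS.
by apply: ig => //; exact: segment_compact.
Qed.

Lemma continuous_primitive (g h : R -> R) : continuous g ->
  (forall x : R, is_derive x 1 h (g x)) -> primitive g h.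
Proof.
move=> cg dh; split => [|s t|s t].
- exact: continuous_measurable_fun.
- apply: continuous_compact_integrable; first exact: segment_compact.
  exact: continuous_subspaceT.
rewrite le_eqVlt => /predU1P[<-|st].
  by rewrite set_itv1 Rintegral_set1 subrr.
have ch : continuous h.
  by move=> x; apply: differentiable_continuous; apply/derivable1_diffP.
rewrite /Rintegral (@continuous_FTC2 _ g h)//.
- exact: continuous_subspaceT.
- split => //.
  + by apply: cvg_at_right_filter; exact: ch.
  + by apply: cvg_at_left_filter; exact: ch.
- by move=> x _; rewrite derive1E; apply: derive_val.
Qed.

(** The proof is a change of variable, as h need not be differentiable. For a = 0 the density is 0
    and the primitive constant; for a < 0 the endpoints are swapped, and |a| = -a restores the
    sign. *)
Lemma primitive_affine (g h : R -> R) (k a : R) : primitive g h ->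
  primitive (fun x => a * g (k + a * x)) (fun x => h (k + a * x)).
Proof.
case=> mg ig gh.
have [->|a0] := eqVneq a 0.
  apply: continuous_primitive => [x|x].
    by under eq_fun do rewrite mul0r; exact: cvg_cst.
  by under eq_fun do rewrite mul0r; rewrite mul0r; exact: is_derive_cst.
have mga := measurable_fun_affine k a mg.
have [a_gt0|a_le0] := ltP 0 a.
  have DE s t : (fun x => k + a * x) @^-1` `[k + a * s, k + a * t] = `[s, t]%classic.
    apply/seteqP; split=> x /=; rewrite !in_itv/=;
      by rewrite !lerD2l !ler_pM2l.
  have iga s t := affine_integral k a0 (measurable_itv _) mg (ig (k + a * s) (k + a * t)).
  split=> [|s t|s t st].
  - by apply: measurable_funM.
  - have [+ _] := iga s t; rewrite DE => /(integrableZl _ a).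
    by apply => //; exact: measurable_itv.
  - have [+] := iga s t; rewrite DE gh ?lerD2l ?ler_pM2l// => ia ->.
    by rewrite RintegralZl// gtr0_norm.
have a_lt0 : a < 0 by rewrite lt_neqAle a0.
have DE s t : (fun x => k + a * x) @^-1` `[k + a * t, k + a * s] = `[s, t]%classic.
  apply/seteqP; split=> x /=; rewrite !in_itv/=;
    by rewrite !lerD2l !ler_nM2l// andbC.
have iga s t := affine_integral k a0 (measurable_itv _) mg (ig (k + a * t) (k + a * s)).
split=> [|s t|s t st].
- by apply: measurable_funM.
- have [+ _] := iga s t; rewrite DE => /(integrableZl _ a).
  by apply => //; exact: measurable_itv.
- have [+] := iga s t; rewrite DE gh ?lerD2l ?ler_nM2l// => ia.
  by rewrite RintegralZl// ltr0_norm// mulNr => /eqP; rewrite -eqr_oppLR opprB => /eqP.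
Qed.

Lemma continuous_onemXn (n : nat) : continuous (fun t : R => (1 - t) ^+ n).
Proof.
have cB : continuous (fun t : R => 1 - t).
  by move=> t; apply: cvgB; [exact: cvg_cst|exact: cvg_id].
by move=> t; exact: continuous_comp (cB t) (@exprn_continuous R n _).
Qed.

Lemma primitive_onemXn (n : nat) :
  primitive (fun t => n.+1%:R * (1 - t) ^+ n) (fun t => - (1 - t) ^+ n.+1).
Proof.
apply: continuous_primitive => [t|t].
  by apply: cvgM; [exact: cvg_cst|exact: continuous_onemXn].
rewrite (_ : (fun _ => _) = - (cst 1 - id) ^+ n.+1); last first.
  by apply/funext => x; rewrite !fctE.
apply: is_derive_eq; rewrite !fctE sub0r /=.
by rewrite scalerN opprK -[RHS]mulr1.
Qed.

(* Fubini on the triangle 0 <= u <= t <= 1 replaces integration by parts, as h is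
   only absolutely continuous. *)
Lemma Rintegral_onemX_primitive (g h : R -> R) (q : nat) : primitive g h ->
  \int[mu]_(t in `[0, 1]) ((1 - t) ^+ q.+1 * g t) =
  q.+1%:R * \int[mu]_(t in `[0, 1]) ((1 - t) ^+ q * h t) - h 0.
Proof.
case=> mg ig gh.
pose w (q : nat) (t : R) : R := (1 - t) ^+ q.
have cw n : continuous (w n) by exact: continuous_onemXn.
have mw n : measurable_fun setT (w n) by exact: continuous_measurable_fun.
have w01 n t : t \in `[0, 1] -> `|w n t| <= 1.
  rewrite in_itv/= => /andP[t0 t1]; rewrite normrX ger0_norm ?subr_ge0//.
  by rewrite exprn_ile1// ?subr_ge0// gerBl.
(* Integrating [K u t] in t over [u, 1] gives (1 - u)^(q + 1) g u, and in u over [0, t] gives (q +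
   1) (1 - t)^q (h t - h 0): the two sides to be compared. *)
pose K (u t : R) := if u <= t then q.+1%:R * w q t * g u else 0.
have mK : measurable_fun setT (fun z : R * R => K z.1 z.2).
  apply: measurable_fun_ifT.
  - by apply: measurable_fun_ler.
  - apply: measurable_funM; last exact: measurableT_comp.
    by apply: measurable_funM => //; exact: measurableT_comp.
  - exact: measurable_cst.
have Kg u t : t \in `[0, 1] -> `|K u t| <= q.+1%:R * `|g u|.
  move=> t01; rewrite /K; case: ifPn => _.
    by rewrite !normrM normr_nat -mulrA ler_wpM2l// ler_piMl// w01.
  by rewrite normr0 mulr_ge0.
have m01 : measurable `[(0 : R), 1] by exact: measurable_itv.
have iB : mu.-integrable `[0, 1] (EFin \o (fun u => q.+1%:R * `|g u|)).
  exact: integrableZl (integrable_norm (ig 0 1)).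
have iKx u : `[0, 1]%classic u -> mu.-integrable `[0, 1] (EFin \o K u).
  move=> _; apply: (@le_integrable _ _ _ mu _ _ _ (EFin \o cst (q.+1%:R * `|g u|))) => //.
  - apply/measurable_EFinP/measurable_funTS.
    exact: (measurable_fun_pair2 u mK).
  - move=> t t01; rewrite /= lee_fin (le_trans (Kg u t t01))//.
    exact: ler_norm.
  - apply: continuous_compact_integrable; first exact: segment_compact.
    by apply: continuous_subspaceT => x; exact: cvg_cst.
have iKy t : `[0, 1]%classic t -> mu.-integrable `[0, 1] (EFin \o K^~ t).
  move=> t01; apply: le_integrable iB => //.
  - apply/measurable_EFinP/measurable_funTS.
    exact: (measurable_fun_pair1 t mK).
  - move=> u _; rewrite /= lee_fin (le_trans (Kg u t t01))//.
    exact: ler_norm.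
have KB u : `[0, 1]%classic u ->
    (\int[mu]_(t in `[0%R, 1%R]) `|K u t|%:E <= (q.+1%:R * `|g u|)%:E)%E.
  move=> u01; have /integrableP[mKu _] := iKx u u01.
  apply: (@le_trans _ _ (integral mu `[0, 1] (cst (q.+1%:R * `|g u|)%:E))).
    apply: ge0_le_integral => //.
      by apply/measurable_EFinP/measurableT_comp => //; exact/measurable_EFinP.
    by move=> t t01; rewrite lee_fin Kg.
  by rewrite integral_cst//= lebesgue_measure_itv/= lte_fin ltr01 oppr0 adde0 mule1.
have := Rintegral_fubini m01 m01 mK iKx iKy iB KB.
have := integrable_Rintegral_snd m01 m01 mK iKy iB KB.
have Kt t : t \in `[0, 1] ->
    \int[mu]_(u in `[0, 1]) K u t = q.+1%:R * w q t * (h t - h 0).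
  rewrite in_itv/= => /andP[t0 t1]; rewrite -gh// -RintegralZl//.
  rewrite [LHS]Rintegral_mkcond [RHS]Rintegral_mkcond; apply: eq_Rintegral => u _.
  rewrite !patchE !mem_setE !in_itv/= /K.
  case: (leP 0 u) => //= u0; have [ut|ut] := leP u t; last by case: ifP.
  by rewrite (le_trans ut t1).
have [mW iW W] := primitive_onemXn q.
have Ku u : u \in `[0, 1] -> \int[mu]_(t in `[0, 1]) K u t = w q.+1 u * g u.
  rewrite in_itv/= => /andP[u0 u1].
  transitivity (\int[mu]_(t in `[u, 1]) (q.+1%:R * w q t * g u)); last first.
    by rewrite RintegralZr// W// /w subrr expr0n/= oppr0 add0r opprK.
  rewrite [LHS]Rintegral_mkcond [RHS]Rintegral_mkcond; apply: eq_Rintegral => t _.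
  rewrite !patchE !mem_setE !in_itv/= /K.
  by have [ut|ut] := leP u t; [rewrite (le_trans u0 ut)|case: ifP].
move=> iJ fub.
pose J t := q.+1%:R * w q t * (h t - h 0).
have KJ : {in `[0, 1]%classic, (fun t => \int[mu]_(u in `[0, 1]) K u t) =1 J}.
  by move=> t; rewrite mem_setE; exact: Kt.
have {}iJ : mu.-integrable `[0, 1] (EFin \o J).
  by apply: eq_integrable iJ => // t t01; rewrite /= KJ.
transitivity (\int[mu]_(t in `[0, 1]) J t).
  transitivity (\int[mu]_(t in `[0, 1]) (\int[mu]_(u in `[0, 1]) K u t)).
    rewrite -fub; apply: eq_Rintegral => u u01.
    by rewrite Ku//; move: u01; rewrite mem_setE.
  by apply: eq_Rintegral => t t01; rewrite KJ.
have iW0 : mu.-integrable `[0, 1] (EFin \o (fun t => h 0 * (q.+1%:R * w q t))).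
  exact: integrableZl (iW 0 1).
have q0 : q.+1%:R != 0 :> R by rewrite pnatr_eq0.
(* The definition of [J] is solved for h, so that the integrability needed to split the integral
   comes from [iJ], hence from Fubini, and not from regularity of h. *)
have -> : \int[mu]_(t in `[0, 1]) ((1 - t) ^+ q * h t) =
    \int[mu]_(t in `[0, 1]) (q.+1%:R^-1 * (J t + h 0 * (q.+1%:R * w q t))).
  apply: eq_Rintegral => t _; rewrite /J -/(w q t); field.
  by rewrite addrC natr1.
rewrite RintegralZl//; last by have /= := integrableD _ iJ iW0; apply.
rewrite RintegralD// RintegralZl// W// mulVKf//.
by rewrite /w subrr subr0 expr0n expr1n/=; ring.
Qed.

(** Induction on p: the base case is the definition of a primitive on [0, 1], and
    [Rintegral_onemX_primitive] splits each remainder into the next Taylor term and the next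
    remainder. *)
Lemma taylor_primitives (phi : nat -> R -> R) (p : nat) :
  (forall q, (q < p.+1)%N -> primitive (phi q.+1) (phi q)) ->
  phi 0%N 1 = \sum_(0 <= i < p.+1) phi i 0 / i`!%:R +
    (\int[mu]_(t in `[0, 1]) ((1 - t) ^+ p * phi p.+1 t)) / p`!%:R.
Proof.
elim: p => [|p IH] prim.
  rewrite big_nat1 fact0 !divr1; under eq_Rintegral do rewrite expr0 mul1r.
  by have [_ _ ->] := prim 0%N isT => //; rewrite addrC subrK.
rewrite IH => [|q qp]; last by apply: prim; rewrite ltnW.
rewrite [in RHS]big_nat_recr//= -[RHS]addrA.
congr (_ + _).
rewrite (Rintegral_onemX_primitive p (prim p.+1 _))// factS natrM.
by field; rewrite addrC natr1 !pnatr_eq0 -lt0n fact_gt0.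
Qed.
End primitives.

Section primitive_algebra.
Context {R : realType}.
Local Notation mu := (@lebesgue_measure R).

Lemma primitiveZ (c : R) (g h : R -> R) : primitive g h ->
  primitive (fun x => c * g x) (fun x => c * h x).
Proof.
case=> mg ig gh; split=> [|s t|s t st]; first by apply: measurable_funM.
- exact: integrableZl (ig s t).
- by rewrite RintegralZl// gh// mulrBr.
Qed.

Lemma primitiveD (g1 g2 h1 h2 : R -> R) : primitive g1 h1 -> primitive g2 h2 ->
  primitive (fun x => g1 x + g2 x) (fun x => h1 x + h2 x).
Proof.
move=> [mg1 ig1 gh1] [mg2 ig2 gh2]; split=> [|s t|s t st].
- exact: measurable_funD.
- by have /= := integrableD _ (ig1 s t) (ig2 s t); apply.
- by rewrite RintegralD// gh1// gh2//; ring.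
Qed.

Lemma primitive_sum (n : nat) (g h : nat -> R -> R) :
  (forall i, (i < n)%N -> primitive (g i) (h i)) ->
  primitive (fun x => \sum_(0 <= i < n) g i x) (fun x => \sum_(0 <= i < n) h i x).
Proof.
elim: n => [_|n IH gh].
  have <- : (fun x => 0 : R) = (fun x => \sum_(0 <= i < 0) g i x).
    by apply/funext => x; rewrite big_geq.
  have <- : (fun x => 0 : R) = (fun x => \sum_(0 <= i < 0) h i x).
    by apply/funext => x; rewrite big_geq.
  by apply: continuous_primitive => x; exact: cvg_cst.
under [X in primitive X _]eq_fun do rewrite big_nat_recr//=.
under [X in primitive _ X]eq_fun do rewrite big_nat_recr//=.
by apply: primitiveD (gh _ _) => //; apply: IH => i /ltnW; exact: gh.
Qed.

Lemma primitiveXn (n : nat) :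
  primitive (fun x : R => x ^+ n) (fun x : R => x ^+ n.+1 / n.+1%:R).
Proof.
apply: continuous_primitive => [|x]; first exact: exprn_continuous.
rewrite (_ : (fun _ => _) = n.+1%:R^-1 \*: (id ^+ n.+1)); last first.
  by apply/funext => y; rewrite mulrC !fctE.
apply: is_derive_eq; rewrite /= /GRing.scale/= mulr1 mulrA mulVf ?mul1r//.
Qed.

Lemma integrable_continuousM (c u : R -> R) (s t : R) : continuous c ->
  mu.-integrable `[s, t] (EFin \o u) ->
  mu.-integrable `[s, t] (EFin \o (fun x => c x * u x)).
Proof.
move=> cc iu.
have bc : [bounded c x | x in `[s, t]%classic].
  have /compact_bounded[M [Mr cM]] : compact (c @` `[s, t]%classic).
    by apply: continuous_compact (@segment_compact _ s t); exact: continuous_subspaceT.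
  exists M; split; first by rewrite num_real.
  by move=> M' MM' x xst; apply: cM => //; exists x.
have mc : measurable_fun `[s, t] c.
  by apply: measurable_funTS; exact: continuous_measurable_fun.
by have /= := @integrableMr _ _ _ mu _ _ c _ mc bc iu; apply.
Qed.

(** For a <> 0 the factor a produced by [primitive_affine] is divided out; for a = 0 the integrand
    is constant. *)
Lemma integrable_affine (g h : R -> R) (k a s t : R) : primitive g h ->
  mu.-integrable `[s, t] (EFin \o (fun x => g (k + a * x))).
Proof.
move=> gh; have [->|a0] := eqVneq a 0.
  apply: continuous_compact_integrable; first exact: segment_compact.
  apply: continuous_subspaceT => x; under eq_fun do rewrite mul0r.
  exact: cvg_cst.
have [_ /(_ s t) ig _] := primitiveZ a^-1 (primitive_affine k a gh).
by apply: eq_integrable ig => // x _; rewrite /= mulKf.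
Qed.

Lemma taylor_integral_remainder (D : nat -> R -> R) (p : nat) (k x : R) :
  (forall q, (q < p.+1)%N -> primitive (D q.+1) (D q)) ->
  D 0%N (k + x) = \sum_(0 <= i < p.+1) D i k * x ^+ i / i`!%:R +
    x ^+ p.+1 * (\int[mu]_(s in `[0, 1]) ((1 - s) ^+ p * D p.+1 (k + x * s))) / p`!%:R.
Proof.
move=> Dprim.
(* Following [D] along the segment from k to k + x, parametrized by t in [0, 1], handles both signs
   of x. The factor x^i comes from the chain rule. *)
pose phi i t := x ^+ i * D i (k + x * t).
have phiprim q : (q < p.+1)%N -> primitive (phi q.+1) (phi q).
  move=> /Dprim /(primitive_affine k x) /(primitiveZ (x ^+ q)).
  by under [X in primitive X _]eq_fun do rewrite mulrA -exprSr.
have := taylor_primitives phiprim; rewrite /phi expr0 mul1r mulr1 => ->.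
congr (_ + _ / _).
  by apply: eq_bigr => i _; rewrite mulr0 addr0 (mulrC (x ^+ i)).
under eq_Rintegral do rewrite mulrCA.
rewrite RintegralZl//; apply: integrable_continuousM.
  exact: continuous_onemXn.
exact: integrable_affine (Dprim p _).
Qed.

End primitive_algebra.

(** * The remainder *)

Section symmetric_remainder.
Context {R : realType}.
Local Notation mu := (@lebesgue_measure R).
Variables (D : nat -> R -> R) (p : nat) (k h : R).
Hypothesis Dprim : forall q, (q < p.+1)%N -> primitive (D q.+1) (D q).
Hypothesis h_gt0 : 0 < h.
Local Notation g := (D p.+1).

Let mg : measurable_fun setT g.
Proof. by have [] := Dprim (ltnSn p). Qed.

Let c (s : R) : R := (1 - s) ^+ p.

Let cc : continuous c. Proof. exact: continuous_onemXn. Qed.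

Let K (v s : R) : R := c s * (v ^+ p.+1 * g (k + h * s * v)).

Let mK : measurable_fun setT (fun z : R * R => K z.1 z.2).
Proof.
apply: measurable_funM.
  by apply: measurableT_comp => //; exact: continuous_measurable_fun.
apply: measurable_funM; first by apply: measurable_funX.
apply: measurableT_comp => //; apply: measurable_funD => //.
by apply: measurable_funM => //; apply: measurable_funM.
Qed.

Lemma integrable_Xn_affine s :
  mu.-integrable `[-1, 1] (EFin \o (fun v => v ^+ p.+1 * g (k + h * s * v))).
Proof.
apply: integrable_continuousM; first exact: exprn_continuous.
exact: integrable_affine (Dprim (ltnSn p)).
Qed.

Let iKv s : `[0, 1]%classic s -> mu.-integrable `[-1, 1] (EFin \o K^~ s).
Proof. by move=> _; exact: integrableZl (integrable_Xn_affine s). Qed.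

Let iKs v : `[-1, 1]%classic v -> mu.-integrable `[0, 1] (EFin \o K v).
Proof.
move=> _; have := integrableZl _ (v ^+ p.+1)
  (integrable_continuousM cc (integrable_affine k (h * v) 0 1 (Dprim (ltnSn p)))).
move=> /(_ (measurable_itv _)); apply: eq_integrable => // s _.
by rewrite /K /= -EFinM mulrCA (mulrAC h).
Qed.

Let C : R := \int[mu]_(x in `[k - h, k + h]) `|g x|.

(** For v <> 0 the substitution x = k + h v s bounds the integral of |g (k + h v s)| over s by C /
    (h |v|). One factor |v| of v^(p + 1) cancels the singularity at v = 0; the other factors of the
    kernel are at most 1. *)
Let KB v : `[-1, 1]%classic v ->
  (\int[mu]_(s in `[0%R, 1%R]) `|K v s|%:E <= ((fun=> C / h) v)%:E)%E.
Proof.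
have C0 : 0 <= C by apply: Rintegral_ge0.
rewrite /= in_itv/= => /andP[v1 v2].
have [->|v0] := eqVneq v 0.
  rewrite integral0_eq ?lee_fin ?divr_ge0// ?ltW// => s _.
  by rewrite /K expr0n mul0r mulr0 normr0.
(* Cutting |g| off outside [k - h, k + h] allows the substitution on the whole line; for s in [0, 1]
   and |v| <= 1 the point k + h v s stays inside. *)
pose phi : R -> \bar R := (fun x => `|g x|%:E) \_ `[k - h, k + h].
have mphi : measurable_fun setT phi.
  apply/(measurable_restrictT _ _).1; first exact: measurable_itv.
  apply/measurable_EFinP/measurable_funTS.
  by apply: measurableT_comp.
have phi0 x : (0 <= phi x)%E by rewrite /phi patchE; case: ifP.
have hv : h * v != 0 by rewrite mulf_neq0// gt_eqF.
have phiC : (\int[mu]_x phi x = C%:E)%E.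
  rewrite /phi -integral_mkcond /C /Rintegral fineK//.
  have [_ + _] := Dprim (ltnSn p) => /(_ (k - h) (k + h)) /integrable_norm.
  by move=> /integrable_fin_num; apply; exact: measurable_itv.
have mphi' : measurable_fun setT (fun s => phi (k + h * v * s)).
  exact: measurable_fun_affine.
apply: (@le_trans _ _ (`|v|%:E * \int[mu]_s phi (k + h * v * s)%R)%E).
  rewrite -ge0_integralZl// [leLHS]integral_mkcond; apply: ge0_le_integral => //.
  - by move=> s _; rewrite patchE; case: ifP.
  - apply/(measurable_restrictT _ _).1; first exact: measurable_itv.
    apply/measurable_EFinP/measurable_funTS/measurableT_comp => //.
    exact: (measurable_fun_pair2 v mK).
  - exact: measurable_funeM.
  - move=> s _; rewrite patchE mem_setE; case: ifPn => s01; last by rewrite mule_ge0.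
    move: s01; rewrite in_itv/= => /andP[s0 s1].
    have vs : `|v * s| <= 1.
      by rewrite normrM mulr_ile1// ?(ger0_norm s0)// ler_norml v1.
    have vs' : `|h * v * s| <= h.
      by rewrite -mulrA normrM gtr0_norm// ler_piMr// ltW.
    rewrite /phi patchE mem_setE in_itv/= ifT; last first.
      by move: vs'; rewrite ler_norml; lra.
    rewrite -EFinM lee_fin /K (mulrAC h s) !normrM normrX mulrA.
    apply: ler_wpM2r => //; rewrite normrX exprS mulrCA ler_piMr//.
    have s1' : `|1 - s| <= 1 by rewrite ger0_norm ?subr_ge0// gerBl.
    have v1' : `|v| <= 1 by rewrite ler_norml v1.
    by rewrite mulr_ile1 ?exprn_ge0 ?exprn_ile1.
have := ge0_integral_affine k hv mphi phi0; rewrite phiC normrM gtr0_norm//.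
rewrite EFinM -muleA => CE.
by rewrite EFinM lee_pdivlMr// muleC -CE.
Qed.

Let mD : measurable `[(-1 : R), 1]. Proof. exact: measurable_itv. Qed.
Let mE : measurable `[(0 : R), 1]. Proof. exact: measurable_itv. Qed.

Let iB : mu.-integrable `[-1, 1] (EFin \o (fun=> C / h)).
Proof.
apply: continuous_compact_integrable; first exact: segment_compact.
by apply: continuous_subspaceT => x; exact: cvg_cst.
Qed.

Let innerE s : \int[mu]_(v in `[-1, 1]) K v s =
  c s * \int[mu]_(v in `[-1, 1]) (v ^+ p.+1 * g (k + h * s * v)).
Proof. by rewrite RintegralZl//; exact: integrable_Xn_affine. Qed.

Lemma integrable_remainder_density :
  mu.-integrable `[0, 1] (EFin \o (fun s => (1 - s) ^+ p *
    \int[mu]_(v in `[-1, 1]) (v ^+ p.+1 * g (k + h * s * v)))).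
Proof.
have := integrable_Rintegral_snd mD mE mK iKv iB KB.
by apply: eq_integrable => // s _; rewrite /= innerE.
Qed.

(** After the exchange of the integrals, the inner one in s is the Taylor error of [D 0] at k with
    increment h v, up to a factor depending on h and p only. Integrating that error in v over
    [-1, 1] produces the increment of F and the polynomial terms. *)
Lemma symmetric_remainder (F : R -> R) : primitive (D 0%N) F ->
  F (k + h) - F (k - h) =
  \sum_(0 <= i < p.+1) (1 + (-1) ^+ i) * D i k * h ^+ i.+1 / i.+1`!%:R +
  h ^+ p.+2 / p`!%:R * \int[mu]_(s in `[0, 1]) ((1 - s) ^+ p *
    \int[mu]_(v in `[-1, 1]) (v ^+ p.+1 * g (k + h * s * v))).
Proof.
move=> FD.
have fact0' : p`!%:R != 0 :> R by rewrite pnatr_eq0 -lt0n fact_gt0.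
have h0 : h != 0 by rewrite gt_eqF.
have -> : \int[mu]_(s in `[0, 1]) ((1 - s) ^+ p *
    \int[mu]_(v in `[-1, 1]) (v ^+ p.+1 * g (k + h * s * v))) =
    \int[mu]_(v in `[-1, 1]) (\int[mu]_(s in `[0, 1]) K v s).
  rewrite (Rintegral_fubini mD mE mK iKs iKv iB KB).
  by apply: eq_Rintegral => s _; rewrite innerE.
(* [G v] is h times the Taylor error, the factor h being what makes F (k + h v) a primitive of its
   first term; [H] is the resulting primitive. *)
pose G v := h * D 0%N (k + h * v) +
  (- h) * \sum_(0 <= i < p.+1) (D i k * h ^+ i / i`!%:R * v ^+ i).
pose H v := F (k + h * v) +
  (- h) * \sum_(0 <= i < p.+1) (D i k * h ^+ i / i`!%:R * (v ^+ i.+1 / i.+1%:R)).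
have GH : primitive G H.
  apply: primitiveD; first exact: primitive_affine.
  apply: primitiveZ; apply: primitive_sum => i _.
  by apply: primitiveZ; exact: primitiveXn.
have KG v : \int[mu]_(s in `[0, 1]) K v s = p`!%:R / h ^+ p.+2 * G v.
  transitivity (v ^+ p.+1 *
      \int[mu]_(s in `[0, 1]) (c s * g (k + h * v * s))).
    rewrite -RintegralZl//; last first.
      exact: integrable_continuousM (integrable_affine _ _ _ _ (Dprim (ltnSn p))).
    by apply: eq_Rintegral => s _; rewrite /K mulrCA (mulrAC h).
  rewrite /G (taylor_integral_remainder _ _ Dprim).
  set S := \sum_(_ <= _ < _) _; set S' := \sum_(_ <= _ < _) _.
  have -> : S' = S.
    by apply: eq_bigr => i _; rewrite exprMn; ring.
  rewrite -/(c _).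
  move: (Rintegral _ _ _) => J.
  rewrite exprMn !exprS. have := expf_neq0 p h0; move: (h ^+ p) (v ^+ p) => hp vp hp0.
  by field; rewrite ?fact0' ?hp0 ?h0.
have -> : \int[mu]_(v in `[-1, 1]) (\int[mu]_(s in `[0, 1]) K v s) =
    \int[mu]_(v in `[-1, 1]) (p`!%:R / h ^+ p.+2 * G v).
  by apply: eq_Rintegral => v _; rewrite KG.
case: GH => _ iG GH; rewrite RintegralZl// GH; last lra.
rewrite [X in _ = _ + X](_ : _ = H 1 - H (-1)); last first.
  by field; rewrite ?fact0' ?expf_neq0.
rewrite /H mulr1 mulrN1.
set S := \sum_(_ <= _ < _) _; set A := \sum_(_ <= _ < _) _.
set B := \sum_(_ <= _ < _) _.
(* Evaluating v^(i + 1) at 1 and -1 leaves 1 - (-1)^(i + 1) = 1 + (-1)^i, so only even i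
   contribute. *)
suff -> : S = h * (A - B) by ring.
rewrite -sumrB mulr_sumr; apply: eq_bigr => i _.
rewrite expr1n (exprS (-1)) exprS factS natrM; field.
by rewrite !(addrC 1) !natr1 !pnatr_eq0 -!lt0n ?fact_gt0.
Qed.

End symmetric_remainder.

(** Integrability and value are proved together so that the statement can be nested: its first half
    for sums over k provides the hypothesis for sums over j. *)
Lemma affine_Rintegral_sum {R : realType} (s t : R) (r : seq nat) (c : nat -> R)
    (u : nat -> R -> R) :
    (forall i, i \in r ->
       lebesgue_measure.-integrable `[s, t] (EFin \o u i)) ->
  lebesgue_measure.-integrable `[s, t]
    (EFin \o (fun x => \sum_(i <- r) c i * u i x)) /\
  \int[lebesgue_measure]_(x in `[s, t]) (\sum_(i <- r) c i * u i x) =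
    \sum_(i <- r) c i * \int[lebesgue_measure]_(x in `[s, t]) u i x.
Proof.
elim: r => [|i r IH] iu.
  have -> : (fun x : R => \sum_(i <- [::]) c i * u i x) = cst 0.
    by apply/funext => x; rewrite big_nil.
  split.
    apply: continuous_compact_integrable; first exact: segment_compact.
    by apply: continuous_subspaceT => x; exact: cvg_cst.
  by rewrite big_nil Rintegral_cst// mul0r.
have -> : (fun x : R => \sum_(j <- i :: r) c j * u j x) =
    (fun x => c i * u i x + \sum_(j <- r) c j * u j x).
  by apply/funext => x; rewrite big_cons.
have [ir Er] : _ /\ _ := IH (fun j jr => iu j (mem_behead (s := i :: r) jr)).
have ii := iu i (mem_head i r).
have ci : lebesgue_measure.-integrable `[s, t] (EFin \o (fun x => c i * u i x)).
  exact: integrableZl ii.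
split; first by have /= := integrableD _ ci ir; apply.
by rewrite RintegralD// RintegralZl// Er big_cons.
Qed.

Section remainder_theory.
Context {R : realType}.
Local Notation mu := (@lebesgue_measure R).
Variables (n m : nat) (D : nat -> R -> R).
Hypothesis m_gt0 : (0 < m)%N.
Hypothesis Dprim : forall q, (q < 2 * m)%N -> primitive (D q.+1) (D q).
Local Notation g := (D (2 * m)).

Let p := (2 * m - 1)%N.
Let pE : (2 * m = p.+1)%N. Proof. by rewrite /p; lia. Qed.

Let Phi (k j : nat) (s : R) : R :=
  \int[mu]_(v in `[-1, 1]) (v ^+ (2 * m) * g (k%:R + j%:R / 2 * s * v)).

Let iv k j s : mu.-integrable `[-1, 1]
  (EFin \o (fun v => v ^+ (2 * m) * g (k%:R + j%:R / 2 * s * v))).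
Proof.
have := @integrable_Xn_affine R D p k%:R (j%:R / 2) _ s; rewrite -pE.
by apply; rewrite -?pE.
Qed.

Let iouter k j : (0 < j)%N ->
  mu.-integrable `[0, 1] (EFin \o (fun s => (1 - s) ^+ p * Phi k j s)).
Proof.
move=> j0; have := @integrable_remainder_density R D p k%:R (j%:R / 2).
by rewrite -pE; apply=> //; rewrite divr_gt0// ltr0n.
Qed.

Let c (j : nat) : R := gamma R m j * j%:R ^+ (2 * m + 1).

Let inner (s : R) : R := \int[mu]_(v in `[-1, 1]) (v ^+ (2 * m) *
  \sum_(1 <= j < m.+1) (c j *
    \sum_(0 <= k < n) g (k%:R + j%:R * s * v / 2))).

(** The trivial weights [1 *] on the sum over k match [affine_Rintegral_sum], and j / 2 collected in
    front of s matches [Phi]. *)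
Let integrandE s v : v ^+ (2 * m) *
    \sum_(1 <= j < m.+1) (c j * \sum_(0 <= k < n) g (k%:R + j%:R * s * v / 2)) =
  \sum_(1 <= j < m.+1) c j * \sum_(0 <= k < n)
    1 * (v ^+ (2 * m) * g (k%:R + j%:R / 2 * s * v)).
Proof.
rewrite mulr_sumr; apply: eq_bigr => j _; rewrite mulrCA mulr_sumr.
congr (_ * _); apply: eq_bigr => k _; rewrite mul1r; congr (_ * g (_ + _)).
by ring.
Qed.

Let innerP s : mu.-integrable `[-1, 1] (EFin \o (fun v => v ^+ (2 * m) *
    \sum_(1 <= j < m.+1) (c j * \sum_(0 <= k < n) g (k%:R + j%:R * s * v / 2)))) /\
  inner s = \sum_(1 <= j < m.+1) c j * \sum_(0 <= k < n) 1 * Phi k j s.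
Proof.
have ik j := @affine_Rintegral_sum R (-1) 1 (index_iota 0 n) (fun=> 1)
  (fun k v => v ^+ (2 * m) * g (k%:R + j%:R / 2 * s * v)) (fun k _ => iv k j s).
have [i1 i2] := @affine_Rintegral_sum R (-1) 1 (index_iota 1 m.+1) c _
  (fun j _ => (ik j).1).
split.
  by apply: eq_integrable i1 => // v _; rewrite /= integrandE.
transitivity (\int[mu]_(v in `[-1, 1]) (\sum_(1 <= j < m.+1) c j *
    \sum_(0 <= k < n) 1 * (v ^+ (2 * m) * g (k%:R + j%:R / 2 * s * v)))).
  by apply: eq_Rintegral => v _; rewrite integrandE.
by rewrite i2; apply: eq_bigr => j _; rewrite (ik j).2.
Qed.

Let outerE s : (1 - s) ^+ p * inner s =
  \sum_(1 <= j < m.+1) c j * \sum_(0 <= k < n) 1 * ((1 - s) ^+ p * Phi k j s).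
Proof.
rewrite (innerP s).2 mulr_sumr; apply: eq_bigr => j _; rewrite mulrCA mulr_sumr.
by congr (_ * _); apply: eq_bigr => k _; rewrite !mul1r.
Qed.

Let outerP : mu.-integrable `[0, 1] (EFin \o (fun s => (1 - s) ^+ p * inner s)) /\
  \int[mu]_(s in `[0, 1]) ((1 - s) ^+ p * inner s) =
  \sum_(1 <= j < m.+1) c j * \sum_(0 <= k < n)
    \int[mu]_(s in `[0, 1]) ((1 - s) ^+ p * Phi k j s).
Proof.
have ik j (j0 : (0 < j)%N) := @affine_Rintegral_sum R 0 1 (index_iota 0 n) (fun=> 1)
  (fun k s => (1 - s) ^+ p * Phi k j s) (fun k _ => iouter k j0).
have jr j : j \in index_iota 1 m.+1 -> (0 < j)%N.
  by rewrite mem_index_iota => /andP[].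
have [i1 i2] := @affine_Rintegral_sum R 0 1 (index_iota 1 m.+1) c _
  (fun j jI => (ik j (jr j jI)).1).
split.
  by apply: eq_integrable i1 => // s _; rewrite /= outerE.
transitivity (\int[mu]_(s in `[0, 1]) (\sum_(1 <= j < m.+1) c j *
    \sum_(0 <= k < n) 1 * ((1 - s) ^+ p * Phi k j s))).
  by apply: eq_Rintegral => s _; rewrite outerE.
rewrite i2; apply: eq_big_seq => j /jr j0; rewrite (ik j j0).2.
by congr (_ * _); apply: eq_bigr => k _; rewrite mul1r.
Qed.

Let remE : remainder n m g =
  (p`!%:R * 2 ^+ p.+2)^-1 * \int[mu]_(s in `[0, 1]) ((1 - s) ^+ p * inner s).
Proof. by rewrite -pE -[(2 * m).+1]addn1. Qed.

Lemma remainder_sum (F : R -> R) : primitive (D 0%N) F ->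
  \sum_(0 <= k < n) D 0%N k%:R =
  \sum_(1 <= j < m.+1) gamma R m j *
    \sum_(0 <= k < n) (F (k%:R + j%:R / 2) - F (k%:R - j%:R / 2)) -
  remainder n m g.
Proof.
move=> FD.
have term k j : (0 < j)%N -> F (k%:R + j%:R / 2) - F (k%:R - j%:R / 2) =
    \sum_(0 <= i < 2 * m)
      (1 + (-1) ^+ i) * D i k%:R * (j%:R / 2) ^+ i.+1 / i.+1`!%:R +
    (j%:R / 2) ^+ p.+2 / p`!%:R *
      \int[mu]_(s in `[0, 1]) ((1 - s) ^+ p * Phi k j s).
  move=> j0; have := @symmetric_remainder R D p k%:R (j%:R / 2).
  by rewrite /Phi -pE; apply=> //; rewrite divr_gt0// ltr0n.
(* The derivatives at k are replaced by an arbitrary sequence d. Odd i vanish through 1 + (-1)^i;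
   even i = 2a meet the moment of order 2a + 1, which leaves only i = 0, where the factors 2 and 1/2
   cancel. *)
have main (d : nat -> R) : \sum_(1 <= j < m.+1) gamma R m j *
    (\sum_(0 <= i < 2 * m)
      (1 + (-1) ^+ i) * d i * (j%:R / 2) ^+ i.+1 / i.+1`!%:R) = d 0%N.
  under eq_bigr do rewrite mulr_sumr.
  rewrite exchange_big/= big_ltn; last by rewrite muln_gt0.
  have e i : (i < 2 * m)%N -> \sum_(1 <= j < m.+1) gamma R m j *
      ((1 + (-1) ^+ i) * d i * (j%:R / 2) ^+ i.+1 / i.+1`!%:R) =
      (i == 0)%:R * d i.
    move=> im; transitivity ((1 + (-1) ^+ i) * d i / (2 ^+ i.+1 * i.+1`!%:R) *
        \sum_(1 <= j < m.+1) gamma R m j * j%:R ^+ i.+1).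
      rewrite mulr_sumr; apply: eq_bigr => j _; rewrite expr_div_n; field.
      by rewrite expf_neq0// pnatr_eq0 -lt0n fact_gt0.
    rewrite -signr_odd; have [io|ie] := boolP (odd i).
      by rewrite expr1 subrr !mul0r; case: i io {im} => //= i _; rewrite mul0r.
    have -> : i.+1 = (2 * i./2 + 1)%N by lia.
    rewrite gamma_odd_moment; last lia.
    case: i ie {im} => [|[|i]]//= _; last by rewrite mulr0 mul0r.
    by rewrite expr0 expr1 (_ : 1`! = 1%N)//; field.
  rewrite e; last by rewrite muln_gt0.
  rewrite eqxx mul1r big_nat_cond big1 ?addr0// => i /andP[/andP[i1 im] _].
  by rewrite e// eqn0Ngt i1 mul0r.
rewrite remE outerP.2; apply/esym/eqP; rewrite subr_eq; apply/eqP.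
transitivity (\sum_(1 <= j < m.+1) gamma R m j * \sum_(0 <= k < n)
    (\sum_(0 <= i < 2 * m)
      (1 + (-1) ^+ i) * D i k%:R * (j%:R / 2) ^+ i.+1 / i.+1`!%:R +
    (j%:R / 2) ^+ p.+2 / p`!%:R *
      \int[mu]_(s in `[0, 1]) ((1 - s) ^+ p * Phi k j s))).
  apply: eq_big_nat => j /andP[j1 _]; congr (_ * _).
  by apply: eq_bigr => k _; rewrite term.
under eq_bigr do rewrite big_split mulrDr.
rewrite big_split/=; congr (_ + _).
  under eq_bigr do rewrite mulr_sumr.
  by rewrite exchange_big/=; apply: eq_bigr => k _; rewrite main.
(* (j / 2)^(2m + 1) splits into the power of j in [c] and the power of 2 in the prefactor of
   [remainder]. *)
rewrite mulr_sumr; apply: eq_bigr => j _; rewrite /c -mulr_sumr.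
have -> : (2 * m + 1 = p.+2)%N by lia.
rewrite expr_div_n; field.
by rewrite expf_neq0// pnatr_eq0 -lt0n fact_gt0.
Qed.

(** The hypothesis is applied at w = j s v / 2. The integral of v^(2m) over [-1, 1] is 2 / (2m + 1)
    and that of (1 - s)^(2m - 1) over [0, 1] is 1 / (2m); with the prefactor 1 / ((2m - 1)! 2^(2m +
    1)) these give 1 / ((2m + 1)! 2^(2m)). *)
Lemma remainder_bound (M : R) :
    (forall w : R, - (m%:R / 2) <= w <= m%:R / 2 ->
      `|\sum_(0 <= k < n) g (k%:R + w)| <= M) ->
  `|remainder n m g| <= M / ((2 * m + 1)`!%:R * 2 ^+ (2 * m)) *
     \sum_(1 <= j < m.+1) (`|gamma R m j| * j%:R ^+ (2 * m + 1)).
Proof.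
move=> gM.
pose S : R := \sum_(1 <= j < m.+1) (`|gamma R m j| * j%:R ^+ (2 * m + 1)).
have even2m (v : R) : `|v ^+ (2 * m)| = v ^+ (2 * m).
  by rewrite ger0_norm// exprM exprn_ge0// sqr_ge0.
have innerB s : 0 <= s <= 1 -> `|inner s| <= M * S * (2 / (2 * m + 1)%:R).
  move=> /andP[s0 s1]; have [i _] := innerP s.
  apply: (le_trans (le_normr_Rintegral _ i)); first exact: measurable_itv.
  have [_ iX X] := primitiveZ (M * S) (@primitiveXn R (2 * m)).
  rewrite (_ : M * S * _ = \int[mu]_(v in `[-1, 1]) (M * S * v ^+ (2 * m))); last first.
    rewrite X; last lra.
    by rewrite expr1n exprS exprM sqrrN expr1n expr1n addn1; ring.
  apply: le_Rintegral => //; first exact: integrable_norm i.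
  move=> v; rewrite /= in_itv/= => /andP[v1 v2].
  rewrite normrM even2m mulrC; apply: ler_wpM2r; first by rewrite -even2m.
  apply: le_trans (ler_norm_sum _ _ _) _; rewrite mulr_sumr.
  rewrite !big_seq; apply: ler_sum => j; rewrite mem_index_iota => /andP[j1 jm].
  rewrite normrM mulrC [`|c j|](_ : _ = `|gamma R m j| * j%:R ^+ (2 * m + 1)).
    apply: ler_wpM2r; first by rewrite mulr_ge0// exprn_ge0.
    have jR : (j%:R : R) <= m%:R by rewrite ler_nat -ltnS.
    have sv : `|s * v| <= 1.
      by rewrite normrM mulr_ile1// ?(ger0_norm s0)// ler_norml v1.
    have w : `|j%:R * s * v / 2| <= m%:R / 2.
      rewrite normrM [`|2^-1|]ger0_norm ?invr_ge0// ler_pM2r ?invr_gt0//.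
      rewrite -mulrA normrM normr_nat (le_trans _ jR)// ler_piMr//.
    by apply: gM; rewrite -ler_norml.
  by rewrite /c normrM normrX normr_nat.
have cst_ge0 : 0 <= (p`!%:R * 2 ^+ p.+2)^-1 :> R.
  by rewrite invr_ge0 mulr_ge0// exprn_ge0.
rewrite remE normrM ger0_norm//.
have [io _] := outerP.
have oB : `|\int[mu]_(s in `[0, 1]) ((1 - s) ^+ p * inner s)| <=
    M * S * (2 / (2 * m + 1)%:R) / p.+1%:R.
  apply: (le_trans (le_normr_Rintegral _ io)); first exact: measurable_itv.
  have [_ iX X] := primitiveZ (M * S * (2 / (2 * m + 1)%:R) / p.+1%:R)
    (@primitive_onemXn R p).
  rewrite (_ : M * S * _ / _ = \int[mu]_(s in `[0, 1])
      (M * S * (2 / (2 * m + 1)%:R) / p.+1%:R * (p.+1%:R * (1 - s) ^+ p))); last first.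
    by rewrite X// subrr subr0 expr0n expr1n/=; ring.
  apply: le_Rintegral => //; first exact: integrable_norm io.
  move=> s; rewrite /= in_itv/= => /andP[s0 s1].
  rewrite mulrA divfK ?pnatr_eq0// normrM [`|(1 - s) ^+ p|]ger0_norm; last first.
    by rewrite exprn_ge0// subr_ge0.
  rewrite [leLHS]mulrC.
  by apply: ler_wpM2r; rewrite ?exprn_ge0 ?subr_ge0// innerB// s0.
apply: le_trans (ler_wpM2l cst_ge0 oB) _.
rewrite -/S addn1 factS pE factS !natrM exprS le_eqVlt; apply/orP; left; apply/eqP.
field.
by rewrite expf_neq0//= nat1r -natrD !pnatr_eq0 -lt0n fact_gt0.
Qed.
End remainder_theory.

(** * Regrouping and telescoping of the integrals *)

(** [gamma] vanishes for j > m, as its binomial coefficient does, so [sum_antisymmetric_range]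
    applies; its inner sum over b is [tau] by [tau_widen], taken with the common bound m. *)
Lemma sum_gamma_tau (R : realType) (m : nat) (phi : int -> R) : (0 < m)%N ->
  \sum_(1 <= j < m.+1) gamma R m j *
    (\sum_(0 <= i < j) phi ((2 * i).+1%:Z - j%:Z)) =
  tau R m 1 * phi 0 +
  \sum_(1 <= a < m) tau R m (1 + a) * (phi a%:Z + phi (- a%:Z)).
Proof.
move=> m0; rewrite sum_antisymmetric_range => [|j jm]; last first.
  by rewrite /gamma bin_small ?mulr0 ?mul0r//; lia.
have tauE a : \sum_(0 <= b < m) gamma R m (1 + a + 2 * b) = tau R m (1 + a).
  by rewrite -tau_widen//; lia.
rewrite big_ltn// eqxx tauE addn0; congr (_ + _).
by apply: eq_big_nat => a /andP[a1 _]; rewrite tauE eqn0Ngt a1.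
Qed.

Lemma sum_zrange_tau (R : realType) (m : nat) (phi : int -> R) : (0 < m)%N ->
  \sum_(al <- zrange (1 - m%:Z) (m%:Z - 1)) tau R m (1 + `|al|)%N * phi al =
  tau R m 1 * phi 0 +
  \sum_(1 <= a < m) tau R m (1 + a) * (phi a%:Z + phi (- a%:Z)).
Proof.
move=> m0; rewrite (sum_zrange (fun al => tau R m (1 + `|al|)%N * phi al))//.
by congr (_ + _); apply: eq_bigr => a _; rewrite abszN absz_nat mulrDr.
Qed.

(** Each central difference is a sum of j differences over unit steps. With the order of summation
    exchanged, the sum over k telescopes for every fixed i. *)
Lemma sum_central_differences (R : realType) (F : R -> R) (n j : nat) :
  \sum_(0 <= k < n) (F (k%:R + j%:R / 2) - F (k%:R - j%:R / 2)) =
  \sum_(0 <= i < j) (F (n%:R - 1 + j%:R / 2 - i%:R) - F (- 1 + j%:R / 2 - i%:R)).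
Proof.
transitivity (\sum_(0 <= k < n) \sum_(0 <= i < j)
    (F (k%:R + j%:R / 2 - i%:R) - F (k%:R - 1 + j%:R / 2 - i%:R))).
  apply: eq_bigr => k _.
  have := @telescope_sumr R 0 j (fun i => - F (k%:R + j%:R / 2 - i%:R)) (leq0n _).
  rewrite subr0 opprK (addrC (- F _)).
  rewrite (_ : k%:R + j%:R / 2 - j%:R = k%:R - j%:R / 2); last by field.
  move=> <-; apply: eq_bigr => i _; rewrite opprK [LHS]addrC; congr (_ - F _).
  by rewrite -natr1; ring.
rewrite exchange_big/=; apply: eq_bigr => i _.
have := @telescope_sumr R 0 n (fun k => F (k%:R - 1 + j%:R / 2 - i%:R)) (leq0n _).
rewrite sub0r => <-; apply: eq_bigr => k _; congr (F _ - _).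
by rewrite -natr1; ring.
Qed.

Theorem theorem3p1 (R : realType) (n m : nat) (m_ge1 : (1 <= m)%N)
    (f : R -> R) (f_C : Cminus (2 * m) f)
    (f2m : R -> R) (f2m_RN : is_RN_derivative f^`((2 * m).-1)%classic f2m)
    (F : R -> R) (F_f : forall x : R, is_derive x 1 F (f x)) :
  let I (a b : R) : R := F b - F a in
  let N : R := n%:R in
  let A : R := \sum_(1 <= j < m.+1) (gamma R m j *
    \sum_(0 <= i < j) I (i%:R - j%:R / 2) (N - 1 + j%:R / 2 - i%:R)) in
  let Rm : R := remainder n m f2m in
  [/\ \sum_(0 <= k < n) f k%:R = A - Rm,
      [/\ A = \sum_(1 <= j < m.+1) (gamma R m j *
            \sum_(0 <= i < j) I (- 1 + j%:R / 2 - i%:R)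
                                (N - 1 + j%:R / 2 - i%:R)),
          A = \sum_(al <- zrange (1 - m%:Z) (m%:Z - 1))
            (tau R m (1 + `|al|)%N *
             I (al%:~R / 2 - 1 / 2) (N - 1 / 2 - al%:~R / 2)),
          A = \sum_(al <- zrange (1 - m%:Z) (m%:Z - 1))
            (tau R m (1 + `|al|)%N *
             I (- (1 / 2) - al%:~R / 2) (N - 1 / 2 - al%:~R / 2)),
          A = tau R m 1 * I (- (1 / 2)) (N - 1 / 2) +
            \sum_(1 <= al < m) (tau R m (1 + al) *
              (I (al%:R / 2 - 1 / 2) (N - 1 / 2 - al%:R / 2) +
               I (- (al%:R / 2) - 1 / 2) (N - 1 / 2 + al%:R / 2))) &
          A = tau R m 1 * I (- (1 / 2)) (N - 1 / 2) +
            \sum_(1 <= al < m) (tau R m (1 + al) *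
              (I (- (1 / 2) - al%:R / 2) (N - 1 / 2 - al%:R / 2) +
               I (- (1 / 2) + al%:R / 2) (N - 1 / 2 + al%:R / 2)))],
      [/\ \sum_(1 <= j < m.+1) (gamma R m j * \sum_(0 <= i < j) 1) = 1,
          \sum_(1 <= j < m.+1) (gamma R m j * j%:R) = 1 &
          \sum_(al <- zrange (1 - m%:Z) (m%:Z - 1))
            tau R m (1 + `|al|)%N = 1] &
      forall M : R,
        (forall w : R, - (m%:R / 2) <= w <= m%:R / 2 ->
           `|\sum_(0 <= k < n) f2m (k%:R + w)| <= M) ->
        `|Rm| <= M / ((2 * m + 1)`!%:R * 2 ^+ (2 * m)) *
          \sum_(1 <= j < m.+1) (`|gamma R m j| * j%:R ^+ (2 * m + 1))].
Proof.
move=> I N A Rm.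
(* The chain of primitives ends with [f2m]: classical derivatives give all links but the last, where
   [f2m] is the density of the derivative of order 2m - 1. *)
pose D i := if (i < 2 * m)%N then f^`(i)%classic else f2m.
have D2m : D (2 * m)%N = f2m by rewrite /D ltnn.
have D0 : D 0%N = f by rewrite /D muln_gt0 m_ge1.
have FD : primitive (D 0%N) F.
  rewrite D0; apply: continuous_primitive => //.
  by have [_ + _] := f_C => /(_ 0%N); apply; rewrite muln_gt0.
have Dprim q : (q < 2 * m)%N -> primitive (D q.+1) (D q).
  move=> qm; rewrite /D qm; case: ifPn => [q1m|].
    have [df cf _] := f_C; apply: continuous_primitive => [|x]; first exact: cf.
    by rewrite derive1nS derive1E; apply: DeriveDef => //; exact: df.
  rewrite -leqNgt => mq; apply: is_RN_derivative_primitive.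
  by rewrite (_ : q = (2 * m).-1)//; lia.
(* With al = 2i + 1 - j one has al/2 - 1/2 = i - j/2 and -1/2 - al/2 = -1 + j/2 - i, so [phi1] and
   [phi2] at al are the integrals of the two forms indexed by (j, i). *)
pose phi1 (al : int) := I (al%:~R / 2 - 1 / 2) (N - 1 / 2 - al%:~R / 2).
pose phi2 (al : int) := I (- (1 / 2) - al%:~R / 2) (N - 1 / 2 - al%:~R / 2).
pose A2 : R := \sum_(1 <= j < m.+1) (gamma R m j * \sum_(0 <= i < j)
  I (- 1 + j%:R / 2 - i%:R) (N - 1 + j%:R / 2 - i%:R)).
have castE (i j : nat) : ((2 * i).+1%:Z - j%:Z)%:~R = 2 * i%:R + 1 - j%:R :> R.
  by rewrite rmorphB /= -!pmulrn -[(2 * i).+1]addn1 natrD natrM.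
(* The upper endpoints agree; the lower ones are exchanged by the reversal i -> j - 1 - i. *)
have AA2 : A = A2.
  apply: eq_bigr => j _; congr (_ * _).
  rewrite sumrB sumrB; congr (_ - _).
  rewrite big_nat_rev/= add0n; apply: eq_big_nat => i /andP[_ ij].
  by rewrite natrB// -natr1; congr F; field.
have A1E : A = tau R m 1 * phi1 0 +
    \sum_(1 <= a < m) tau R m (1 + a) * (phi1 a%:Z + phi1 (- a%:Z)).
  rewrite -sum_gamma_tau//; apply: eq_bigr => j _; congr (_ * _).
  by apply: eq_bigr => i _; rewrite /phi1 castE; congr (F _ - F _); field.
have A2E : A = tau R m 1 * phi2 0 +
    \sum_(1 <= a < m) tau R m (1 + a) * (phi2 a%:Z + phi2 (- a%:Z)).
  rewrite AA2 -sum_gamma_tau//; apply: eq_bigr => j _; congr (_ * _).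
  by apply: eq_bigr => i _; rewrite /phi2 castE; congr (F _ - F _); field.
have gamma1 : \sum_(1 <= j < m.+1) (gamma R m j * j%:R) = 1.
  by have := gamma_odd_moment R m_ge1; rewrite muln0 add0n.
have gamma1' : \sum_(1 <= j < m.+1) (gamma R m j * \sum_(0 <= i < j) 1) = 1.
  by under eq_bigr do rewrite sumr_const_nat subn0.
split.
- rewrite -D0 (remainder_sum n m_ge1 Dprim FD) D2m; congr (_ - _).
  rewrite AA2; apply: eq_bigr => j _; congr (_ * _).
  exact: sum_central_differences.
- split.
  + exact: AA2.
  + by rewrite (sum_zrange_tau phi1).
  + by rewrite (sum_zrange_tau phi2).
  + rewrite A1E /phi1; congr (_ + _).
      by rewrite mulr0z mul0r sub0r subr0.
    apply: eq_bigr => a _; rewrite rmorphN/= -pmulrn mulNr opprK.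
    by [].
  + rewrite A2E /phi2; congr (_ + _).
      by rewrite mulr0z mul0r !subr0.
    apply: eq_bigr => a _; rewrite rmorphN/= -pmulrn mulNr opprK.
    by [].
- split => //.
  (* With [phi] constantly 1 the regrouping of the integrals becomes the regrouping of their
     coefficients. *)
  rewrite -[RHS]gamma1' (sum_gamma_tau (fun=> 1))// -(sum_zrange_tau (fun=> 1))//.
  by apply: eq_bigr => al _; rewrite mulr1.
- by move=> M gM; rewrite /Rm -D2m; apply: remainder_bound; rewrite ?D2m.
Qed.
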